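(* Let $d\ge 2$, let $\bar\tau$ be a binary dimension tree with leaves $L(\bar\tau)=\{1,\dots,d\}$, let $\mathbf A_k\in\mathbb C^{n_k\times n_k}$ for $k=1,\dots,d$, let $\boldsymbol\beta=(\beta(i,j))_{i,j=1}^d\in\mathbb C^{d\times d}$ be strictly upper triangular, and let $$\widehat H=\sum_{1\le i<j\le d}\beta(i,j)\,\mathbf A^{(i)}\mathbf A^{(j)}\in\mathbb C^{(n_1\cdots n_d)\times(n_1\cdots n_d)},\qquad \mathbf A^{(k)}=\mathbf I_{n_d}\otimes\cdots\otimes\mathbf I_{n_{k+1}}\otimes\mathbf A_k\otimes\mathbf I_{n_{k-1}}\otimes\cdots\otimes\mathbf I_{n_1}.$$ Then $\widehat H$ admits a TTNO representation $H$ on $\bar\tau$ whose ranks satisfy $r_\ell=2$ at every leaf $\ell\in L(\bar\tau)$ and $$r_\tau=2+\operatorname{rank}\big(\boldsymbol\beta_s(\tau,\bar\tau\setminus\tau)\big)\le 2+d_\tau\qquad\text{for all }\tau\in\mathcal T(\bar\tau)\setminus\{\bar\tau\},$$ where $d_\tau$ is the cardinality of $L(\tau)$, $\boldsymbol\beta_s=\boldsymbol\beta+\boldsymbol\beta^\top$, and $\boldsymbol\beta_s(\tau,\bar\tau\setminus\tau)$ is the $d_\tau\times(d-d_\tau)$ submatrix of $\boldsymbol\beta_s$ obtained by selecting the rows in $L(\tau)$ and the columns in $\{1,\dots,d\}\setminus L(\tau)$.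
   Context: Binary dimension tree: a rooted tree $\bar\tau$ with leaf set $L(\bar\tau)=\{1,\dots,d\}$ defined recursively. A tree with a single leaf $\ell$ is $\tau=\ell$. A tree with more than one leaf is $\tau=(\tau_1,\tau_2)$, where the root has two children that are roots of dimension trees $\tau_1,\tau_2$, and $L(\tau)$ is the disjoint union of $L(\tau_1)$ and $L(\tau_2)$ with $\max L(\tau_1)<\min L(\tau_2)$. Leaf sets are always nonempty sets of consecutive integers. $\mathcal T(\bar\tau)$ denotes the set of all non-leaf subtrees $\tau=(\tau_1,\tau_2)$ occurring in this recursive construction (including $\bar\tau$ itself). Tree tensor network (TTN) on $\bar\tau$ with mode sizes $N_1,\dots,N_d$ and ranks $r_\tau$ ($\tau\in\mathcal T(\bar\tau)\cup L(\bar\tau)$, with $r_{\bar\tau}=1$ for the root): the data consist of basis matrices $\mathbf U_\ell\in\mathbb C^{N_\ell\times r_\ell}$ at the leaves and transfer tensors $C_\tau\in\mathbb C^{r_{\tau_1}\times r_{\tau_2}\times r_\tau}$ for $\tau=(\tau_1,\tau_2)\in\mathcal T(\bar\tau)$ (no rank conditions are imposed on these). Recursively, for $\tau=(\tau_1,\tau_2)$, $\mathbf U_\tau=(\mathbf U_{\tau_2}\otimes\mathbf U_{\tau_1})\,\mathrm{Mat}_{1,2}(C_\tau)$, where $\mathrm{Mat}_{1,2}(C_\tau)\in\mathbb C^{(r_{\tau_1}r_{\tau_2})\times r_\tau}$ merges the first two indices of $C_\tau$ into a row index with the first index running fastest. The tensor $X\in\mathbb C^{N_1\times\cdots\times N_d}$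 represented by the TTN is the one with $\mathrm{vec}(X)=\mathbf U_{\bar\tau}$ (vectorization with first index fastest). TTNO: for a matrix $\widehat H\in\mathbb C^{(n_1\cdots n_d)\times(n_1\cdots n_d)}$, its reshape $H\in\mathbb C^{n_1^2\times\cdots\times n_d^2}$ is the image of $\widehat H$ under the linear bijection determined by $\mathbf B_d\otimes\cdots\otimes\mathbf B_1\mapsto\mathrm{vec}(\mathbf B_1)\circ\cdots\circ\mathrm{vec}(\mathbf B_d)$ for $\mathbf B_k\in\mathbb C^{n_k\times n_k}$ ($\circ$ is the outer product). A TTNO representation of $\widehat H$ on $\bar\tau$ with ranks $r_\tau$ is a TTN on $\bar\tau$ with mode sizes $N_\ell=n_\ell^2$ and ranks $r_\tau$ that represents $H$. *)

(* Defs.v *)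
From mathcomp Require Import all_boot all_order all_algebra.
From mathcomp Require Import mxtens.

Set Implicit Arguments.
Unset Strict Implicit.
Unset Printing Implicit Defensive.

Import GRing.Theory.
Local Open Scope ring_scope.

(* Modes and leaves 1, ..., d are represented by 'I_d, i.e. 0, ..., d.-1. *)

Section DimensionTree.

Variable d : nat.

Inductive dim_tree : Type :=
  | Leaf of 'I_d
  | Node of dim_tree & dim_tree.

Fixpoint leaves (t : dim_tree) : {set 'I_d} :=
  match t with
  | Leaf l => [set l]
  | Node t1 t2 => leaves t1 :|: leaves t2
  end.

(* The last conjunct is max L(t1) < min L(t2), the leaf sets being nonempty; it
   forces the union L(t1) :|: L(t2) to be disjoint. *)
Fixpoint ordered_tree (t : dim_tree) : bool :=
  match t with
  | Leaf _ => true
  | Node t1 t2 =>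
      [&& ordered_tree t1, ordered_tree t2 &
          [forall i in leaves t1, forall j in leaves t2, (i < j)%N]]
  end.

Definition is_dimension_tree (t : dim_tree) : bool :=
  ordered_tree t && (leaves t == [set: 'I_d]).

Fixpoint inner_subtree (t s : dim_tree) : Prop :=
  match t with
  | Leaf _ => False
  | Node t1 t2 => s = t \/ inner_subtree t1 s \/ inner_subtree t2 s
  end.

End DimensionTree.

Arguments Leaf {d}.

(* N_d * (N_{d-1} * ( ... * (N_1 * 1))): the product of the mode sizes in the
   form in which the successive Kronecker products below typecheck. *)
Fixpoint mode_prod (d : nat) : ('I_d -> nat) -> nat :=
  match d with
  | 0 => fun _ => 1%N
  | d'.+1 => fun N =>
      (N ord_max * mode_prod (fun k => N (widen_ord (leqnSn d') k)))%N
  end.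

Lemma mode_prodE (d : nat) (N : 'I_d -> nat) :
  mode_prod N = (\prod_(k < d) N k)%N.
Proof.
elim: d N => [|d IHd] N /=; first by rewrite big_ord0.
by rewrite IHd big_ord_recr mulnC.
Qed.

(* Position of a multi-index in the vectorization, first index fastest. *)
Fixpoint lin_index (d : nat) :
    forall N : 'I_d -> nat, (forall k, 'I_(N k)) -> 'I_(mode_prod N) :=
  match d with
  | 0 => fun _ _ => ord0
  | d'.+1 => fun N i =>
      mxtens_index (i ord_max, lin_index (fun k => i (widen_ord (leqnSn d') k)))
  end.

Lemma lin_indexE (d : nat) (N : 'I_d -> nat) (i : forall k, 'I_(N k)) :
  lin_index i = (\sum_(k < d) i k * \prod_(l < d | l < k) N l)%N :> nat.
Proof.
elim: d N i => [|d IHd] N i /=; first by rewrite big_ord0.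
rewrite IHd big_ord_recr addnC; congr (_ + _ * _)%N => /=.
  apply: eq_bigr => k _; congr (_ * _)%N.
  by rewrite [RHS]big_mkcond big_ord_recr /= ltnNge ltnW //= muln1 -big_mkcond.
rewrite mode_prodE [RHS]big_mkcond big_ord_recr /= ltnn muln1.
by apply: eq_bigr => l _; rewrite ltn_ord.
Qed.

Section Tensors.

Variables (F : fieldType) (d : nat).

Definition tensor (N : 'I_d -> nat) : Type :=
  {ffun {dffun forall k : 'I_d, 'I_(N k)} -> F^o}.

Definition outer (N : 'I_d -> nat) (v : forall k, 'cV[F]_(N k)) : tensor N :=
  [ffun i : {dffun forall k : 'I_d, 'I_(N k)} => \prod_(k < d) v k (i k) ord0].

End Tensors.

(* B_d ⊗ ... ⊗ B_1. *)
Fixpoint kron (F : fieldType) (d : nat) :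
    forall n : 'I_d -> nat, (forall k, 'M[F]_(n k)) -> 'M[F]_(mode_prod n) :=
  match d with
  | 0 => fun _ _ => 1%:M
  | d'.+1 => fun n B =>
      B ord_max *t kron (fun k => B (widen_ord (leqnSn d') k))
  end.

(* mxvec stacks rows; the transposes make the first index run fastest. *)
Definition col_vec (F : fieldType) (m : nat) (B : 'M[F]_m) : 'cV[F]_(m * m) :=
  (mxvec B^T)^T.

Definition is_reshape (F : fieldType) (d : nat) (n : 'I_d -> nat)
    (Hhat : 'M[F]_(mode_prod n)) (H : tensor F (fun k => n k * n k)%N) : Prop :=
  exists phi : {linear 'M[F]_(mode_prod n) -> tensor F (fun k => n k * n k)%N},
    [/\ bijective phi,
        forall B : (forall k, 'M[F]_(n k)),
          phi (kron B) = outer (fun k => col_vec (B k))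
      & H = phi Hhat].

(* For uniformity ranks and transfer tensors are given for every tree over 'I_d;
   a TTN on a given tree only uses the values at its own subtrees. *)
Record ttn (F : fieldType) (d : nat) (N : 'I_d -> nat) := TTN {
  ttn_rank : dim_tree d -> nat;
  ttn_basis : forall l : 'I_d, 'M[F]_(N l, ttn_rank (Leaf l));
  ttn_transfer : forall t1 t2 : dim_tree d,
    'I_(ttn_rank t1) -> 'I_(ttn_rank t2) -> 'I_(ttn_rank (Node t1 t2)) -> F
}.

(* Mat_{1,2}(C): mxtens_index (j, i) is j * r1 + i, so the first index of C is
   the fastest. *)
Definition mat12 (F : fieldType) (r1 r2 r : nat)
    (C : 'I_r1 -> 'I_r2 -> 'I_r -> F) : 'M[F]_(r2 * r1, r) :=
  \matrix_(p, k) C (mxtens_unindex p).2 (mxtens_unindex p).1 k.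

Fixpoint tree_size (d : nat) (N : 'I_d -> nat) (t : dim_tree d) : nat :=
  match t with
  | Leaf l => N l
  | Node t1 t2 => (tree_size N t2 * tree_size N t1)%N
  end.

Fixpoint ttn_mx (F : fieldType) (d : nat) (N : 'I_d -> nat) (Y : ttn F N)
    (t : dim_tree d) : 'M[F]_(tree_size N t, ttn_rank Y t) :=
  match t with
  | Leaf l => ttn_basis Y l
  | Node t1 t2 =>
      (ttn_mx Y t2 *t ttn_mx Y t1) *m mat12 (@ttn_transfer _ _ _ Y t1 t2)
  end.

(* The cast exists iff U_t is a column (root rank 1) of length N_1 ... N_d; the
   last equation is then vec(X) = U_t. *)
Definition ttn_represents (F : fieldType) (d : nat) (N : 'I_d -> nat)
    (t : dim_tree d) (Y : ttn F N) (X : tensor F N) : Prop :=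
  exists e : (tree_size N t = mode_prod N) * (ttn_rank Y t = 1%N),
    forall i : {dffun forall k : 'I_d, 'I_(N k)},
      castmx e (ttn_mx Y t) (lin_index i) ord0 = X i.

Definition is_ttno (F : fieldType) (d : nat) (n : 'I_d -> nat) (t : dim_tree d)
    (Hhat : 'M[F]_(mode_prod n)) (Y : ttn F (fun k => n k * n k)%N) : Prop :=
  exists2 H : tensor F (fun k => n k * n k)%N,
    is_reshape Hhat H & ttn_represents t Y H.

Definition site_op (F : fieldType) (d : nat) (n : 'I_d -> nat)
    (A : forall k, 'M[F]_(n k)) (k : 'I_d) : 'M[F]_(mode_prod n) :=
  kron (fun l => if l == k then A l else 1%:M).

Definition hamiltonian (F : fieldType) (d : nat) (n : 'I_d -> nat)
    (A : forall k, 'M[F]_(n k)) (beta : 'M[F]_d) : 'M[F]_(mode_prod n) :=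
  \sum_(i < d) \sum_(j < d | (i < j)%N)
    beta i j *: (site_op A i *m site_op A j).

Definition strictly_upper (F : fieldType) (d : nat) (beta : 'M[F]_d) : Prop :=
  forall i j : 'I_d, (j <= i)%N -> beta i j = 0.

Definition set_submx (F : fieldType) (d : nat) (M : 'M[F]_d) (S T : {set 'I_d}) :
    'M[F]_(#|S|, #|T|) :=
  mxsub (fun a : 'I_#|S| => enum_val a) (fun b : 'I_#|T| => enum_val b) M.

(* Main.v *)
Require Import Defs.
From HB Require Import structures.
From mathcomp Require Import all_boot all_order all_algebra.
From mathcomp Require Import mxtens ring.
From mathcomp Require Import complex reals.
Import GRing.Theory.
Local Open Scope ring_scope.
Local Open Scope complex_scope.

Set Implicit Arguments.
Unset Strict Implicit.
Unset Printing Implicit Defensive.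

(* For a subtree with leaf set S other than the root, the columns of the basis
   matrix span the identity, the Hamiltonian H_S of the pairs inside S, and the
   operators \sum_(l in S) Q l k A^(l), where the columns of Q are a basis of the
   column space of the block of beta + beta^T with rows in S and columns outside
   S. At a node with children S1 and S2, H_S is H_S1 + H_S2 plus the interaction
   of S1 with S2; the coefficient block of that interaction is part of the S1
   block, and its transpose is part of the S2 block, so it is bilinear in the
   operators available at the two children. *)

(** * Multi-indices and Kronecker products *)

Lemma ord_maxVwiden (d : nat) (k : 'I_d.+1) :
  k = ord_max \/ exists k' : 'I_d, k = widen_ord (leqnSn d) k'.
Proof.
have := ltn_ord k; rewrite ltnS leq_eqVlt => /orP[/eqP kd | kd].
  by left; apply: val_inj.
by right; exists (Ordinal kd); apply: val_inj.
Qed.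

Lemma lin_index_inj (d : nat) (N : 'I_d -> nat) (i j : forall k, 'I_(N k)) :
  lin_index i = lin_index j -> (forall k, i k = j k).
Proof.
elim: d N i j => [|d IHd] N i j /= eq_ij k; first by case: k.
move/(congr1 (@mxtens_unindex _ _)): eq_ij; rewrite !mxtens_indexK => -[eq_max eq_wid].
by case: (ord_maxVwiden k) => [-> // | [k' ->]]; apply: IHd eq_wid k'.
Qed.

(** Index families are plain dependent functions, so pointwise equality does not by itself identify
    the families. *)
Lemma eq_lin_index (d : nat) (N : 'I_d -> nat) (i j : forall k, 'I_(N k)) :
  (forall k, i k = j k) -> lin_index i = lin_index j.
Proof.
elim: d N i j => [//|d IHd] N i j /= eq_ij.
by rewrite eq_ij; congr (mxtens_index (_, _)); apply: IHd => k.
Qed.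

Lemma lin_index_bij (d : nat) (N : 'I_d -> nat) :
  bijective (fun i : {dffun forall k : 'I_d, 'I_(N k)} => lin_index i).
Proof.
apply: inj_card_bij => [i j /lin_index_inj/ffunP //|].
rewrite card_ord mode_prodE card_dep_ffun foldrE big_map big_enum /=.
by apply/eq_leq/eq_bigr => k _; rewrite card_ord.
Qed.

Section Kron.

Variables (F : fieldType).

Lemma kronE (d : nat) (n : 'I_d -> nat) (B : forall k, 'M[F]_(n k))
    (i j : forall k, 'I_(n k)) :
  kron B (lin_index i) (lin_index j) = \prod_(k < d) B k (i k) (j k).
Proof.
elim: d n B i j => [|d IHd] n B i j /=; first by rewrite big_ord0 mxE.
by rewrite tensmxE IHd big_ord_recr mulrC.
Qed.

Lemma kron_mul (d : nat) (n : 'I_d -> nat) (B C : forall k, 'M[F]_(n k)) :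
  kron B *m kron C = kron (fun k => B k *m C k).
Proof.
elim: d n B C => [|d IHd] n B C /=; first by rewrite mulmx1.
by rewrite tensmx_mul IHd.
Qed.

End Kron.

(** * The reshape as an explicit linear bijection *)

Section Reshape.

Variables (F : fieldType) (d : nat) (n : 'I_d -> nat).

Let mode (k : 'I_d) := (n k * n k)%N.

Definition vec_unindex (m : nat) (i : 'I_(m * m)) : 'I_m * 'I_m :=
  enum_val (cast_ord (esym (mxvec_cast m m)) i).

Lemma mxvec_indexK (m : nat) (a b : 'I_m) :
  vec_unindex (mxvec_index a b) = (a, b).
Proof. by rewrite /vec_unindex cast_ordK enum_rankK. Qed.

Lemma col_vecE (m : nat) (B : 'M[F]_m) i :
  col_vec B i ord0 = B (vec_unindex i).2 (vec_unindex i).1.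
Proof. by case/mxvec_indexP: i => a b; rewrite mxvec_indexK !mxE mxvecE mxE. Qed.

(* mxvec numbers the entries of the transpose, so the first component of
   vec_unindex is the column index. *)
Definition op_reshape (M : 'M[F]_(mode_prod n)) : tensor F mode :=
  [ffun i : {dffun forall k : 'I_d, 'I_(mode k)} =>
     M (lin_index (fun k => (vec_unindex (i k)).2))
       (lin_index (fun k => (vec_unindex (i k)).1))].

Lemma op_reshape_linear : linear op_reshape.
Proof. by move=> c M M'; apply/ffunP=> i; rewrite !ffunE !mxE. Qed.

HB.instance Definition _ :=
  GRing.isLinear.Build F _ _ _ op_reshape op_reshape_linear.

Lemma op_reshape_bij : bijective op_reshape.
Proof.
have [g lin_indexK gK] := lin_index_bij n.
exists (fun H : tensor F mode => \matrix_(p, q)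
  H [ffun k => mxvec_index (g q k) (g p k)]) => [M | H].
  apply/matrixP=> p q; rewrite mxE ffunE -[in RHS](gK p) -[in RHS](gK q).
  by congr (M _ _); apply: eq_lin_index => k; rewrite ffunE mxvec_indexK.
apply/ffunP=> i; rewrite ffunE mxE; congr (H _); apply/ffunP=> k; rewrite ffunE.
(* The cancellation [lin_indexK] speaks of finite functions, while [u] is a plain one; tabulating
   [u] bridges the two. *)
have gE (u : forall k, 'I_(n k)) : g (lin_index u) k = u k.
  have <- : lin_index [ffun k => u k] = lin_index u.
    by apply: eq_lin_index => l; rewrite ffunE.
  by rewrite lin_indexK ffunE.
by rewrite !gE; case/mxvec_indexP: (i k) => a b; rewrite mxvec_indexK.
Qed.

Lemma op_reshape_kron (B : forall k, 'M[F]_(n k)) :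
  op_reshape (kron B) = outer (fun k => col_vec (B k)).
Proof.
apply/ffunP=> i; rewrite !ffunE kronE.
by apply: eq_bigr => k _; rewrite col_vecE.
Qed.

Lemma is_reshape_op_reshape (M : 'M[F]_(mode_prod n)) :
  is_reshape M (op_reshape M).
Proof.
by exists op_reshape; split; [apply: op_reshape_bij | apply: op_reshape_kron |].
Qed.

End Reshape.

(** * Leaf sets of subtrees and index positions along a tree *)

Lemma big_disjoint_setU (R : Type) (idx : R) (op : Monoid.com_law idx)
    (I : finType) (A B : {set I}) (f : I -> R) :
  [disjoint A & B] ->
  \big[op/idx]_(i in A :|: B) f i =
    op (\big[op/idx]_(i in A) f i) (\big[op/idx]_(i in B) f i).
Proof. by move=> dAB; rewrite -bigU //; apply: eq_bigl => i; rewrite !inE. Qed.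

Section Trees.

Variable d : nat.

Lemma leaves_neq0 (t : dim_tree d) : leaves t != set0.
Proof.
elim: t => [l | t1 IH1 t2 _] /=; first by apply/set0Pn; exists l; rewrite set11.
by rewrite setU_eq0 negb_and IH1.
Qed.

Lemma ordered_leaves (t1 t2 : dim_tree d) (i j : 'I_d) :
  ordered_tree (Node t1 t2) -> i \in leaves t1 -> j \in leaves t2 -> (i < j)%N.
Proof. by case/and3P=> _ _ /forall_inP lt12 /lt12/forall_inP; apply. Qed.

Lemma disjoint_leaves (t1 t2 : dim_tree d) :
  ordered_tree (Node t1 t2) -> [disjoint leaves t1 & leaves t2].
Proof.
move=> o12; apply/pred0P=> i /=; apply/negP=> /andP[i1 i2].
by have := ordered_leaves o12 i1 i2; rewrite ltnn.
Qed.

Lemma subtree_leaves (t s : dim_tree d) :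
  inner_subtree t s -> leaves s \subset leaves t.
Proof.
elim: t => [//|t1 IH1 t2 IH2] /= [->|[/IH1 | /IH2]] //= st.
  by apply: subset_trans (subsetUl _ _).
by apply: subset_trans (subsetUr _ _).
Qed.

Lemma proper_subset_disjoint (A B S : {set 'I_d}) :
  S \subset A -> [disjoint A & B] -> B != set0 -> S != [set: 'I_d].
Proof.
move=> sSA dAB /set0Pn[x Bx]; apply/eqP=> defS; move: sSA.
by rewrite defS => /subsetP/(_ x (in_setT x)) Ax; rewrite (disjointFr dAB Ax) in Bx.
Qed.

Lemma proper_subtree_leaves (t s : dim_tree d) :
  ordered_tree t -> inner_subtree t s -> s <> t -> leaves s != [set: 'I_d].
Proof.
case: t => [//|t1 t2] ot /= [// | [] /subtree_leaves ss _].
  exact: proper_subset_disjoint ss (disjoint_leaves ot) (leaves_neq0 t2).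
apply: proper_subset_disjoint ss _ (leaves_neq0 t1).
by rewrite disjoint_sym; apply: disjoint_leaves ot.
Qed.

Lemma inner_subtreeP (t s : dim_tree d) :
  inner_subtree t s -> exists s1 s2, s = Node s1 s2.
Proof.
elim: t => [//|t1 IH1 t2 IH2] /= [->|[/IH1 | /IH2]] //; by exists t1, t2.
Qed.

(** The row of [ttn_mx Y t] that belongs to the multi-index [i]; [t2] comes first because it is the
    left Kronecker factor at a node. *)
Fixpoint tree_index (N : 'I_d -> nat) (i : forall k, 'I_(N k)) (t : dim_tree d) :
    'I_(tree_size N t) :=
  match t with
  | Leaf l => i l
  | Node t1 t2 => mxtens_index (tree_index i t2, tree_index i t1)
  end.

Variables (N : 'I_d -> nat) (i : forall k, 'I_(N k)).

Lemma tree_sizeE (t : dim_tree d) :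
  ordered_tree t -> tree_size N t = (\prod_(l in leaves t) N l)%N.
Proof.
elim: t => [l _|t1 IH1 t2 IH2 ot] /=; first by rewrite big_set1.
rewrite big_disjoint_setU ?disjoint_leaves //=; case/and3P: ot => o1 o2 _.
by rewrite IH1 // IH2 // mulnC.
Qed.

(** Every leaf of [t1] precedes every leaf of [t2]: weights in [t1] gain no factor from [t2], while
    those in [t2] gain the full size of [t1]. So the nested order is again first index fastest. *)
Lemma tree_indexE (t : dim_tree d) : ordered_tree t ->
  tree_index i t =
    (\sum_(k in leaves t) i k * \prod_(l in leaves t | l < k) N l)%N :> nat.
Proof.
elim: t => [l _|t1 IH1 t2 IH2 ot] /=.
  rewrite big_set1 big1 ?muln1 // => k.
  by rewrite inE => /andP[/eqP->]; rewrite ltnn.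
have dis := disjoint_leaves ot; have [o1 o2 _] := and3P ot.
rewrite IH1 // IH2 // tree_sizeE // addnC big_distrl /=.
rewrite big_disjoint_setU //=; congr (_ + _)%N; apply: eq_bigr => k kt;
  rewrite [in RHS]big_mkcondr big_disjoint_setU //= -!big_mkcondr /=.
  rewrite [X in (_ * (_ * X))%N]big1 ?muln1 // => l /andP[l2 lk].
  by have := ltn_trans lk (ordered_leaves ot kt l2); rewrite ltnn.
rewrite -mulnA mulnCA mulnC mulnA; congr (_ * _ * _)%N.
by apply: eq_bigl => l; case l1: (l \in _) => //=; rewrite (ordered_leaves ot).
Qed.

Lemma tree_index_root (t : dim_tree d) (e : tree_size N t = mode_prod N) :
  is_dimension_tree t -> cast_ord e (tree_index i t) = lin_index i.
Proof.
case/andP=> ot /eqP lt; apply: val_inj; rewrite /= tree_indexE // lin_indexE lt.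
by apply: eq_big => [k | k _]; rewrite ?inE //; under eq_bigl do rewrite inE.
Qed.

End Trees.

(** * Row selections and coordinate masks *)

Section Restriction.

Variables (F : fieldType) (d : nat).

(** Restriction to [S] comes in two forms: row selection, which changes the size, and a diagonal
    mask, which keeps size [d] so that blocks of different sets multiply without casts. *)
Definition restr_mx (S : {set 'I_d}) : 'M[F]_(#|S|, d) :=
  \matrix_(a, l) (enum_val a == l)%:R.

Definition mask_mx (S : {set 'I_d}) : 'M[F]_d :=
  diag_mx (\row_l (l \in S)%:R).

Lemma restr_mxK (S : {set 'I_d}) : restr_mx S *m (restr_mx S)^T = 1%:M.
Proof.
apply/matrixP=> a b; rewrite !mxE (bigD1 (enum_val a)) //= !mxE eqxx mul1r.
rewrite big1 ?addr0 => [|l la]; last by rewrite !mxE eq_sym (negPf la) mul0r.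
by rewrite eq_sym (inj_eq enum_val_inj).
Qed.

Lemma tr_restr_mul (S : {set 'I_d}) : (restr_mx S)^T *m restr_mx S = mask_mx S.
Proof.
apply/matrixP=> l m; rewrite !mxE.
under eq_bigr do rewrite !mxE.
rewrite -(big_enum_val (A := [in S]) (fun a => (a == l)%:R * (a == m)%:R)) /=.
case: (boolP (l \in S)) => [lS | lS].
  rewrite (bigD1 l) //= eqxx mul1r big1 ?addr0 // => a /andP[_ /negPf->].
  by rewrite mul0r.
rewrite mulr0n mul0rn big1 // => a aS; case: eqP lS => [<- | _]; first by rewrite aS.
by rewrite mul0r.
Qed.

Lemma mask_mxE (S : {set 'I_d}) (m : nat) (M : 'M[F]_(d, m)) i j :
  (mask_mx S *m M) i j = M i j *+ (i \in S).
Proof. by rewrite mul_diag_mx !mxE mulr_natl. Qed.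

Lemma mask_mxI (S T : {set 'I_d}) : mask_mx S *m mask_mx T = mask_mx (S :&: T).
Proof.
apply/matrixP=> i j; rewrite mask_mxE !mxE inE mulrnAC.
by case: (i \in S).
Qed.

Lemma set_submxE (M : 'M[F]_d) (S T : {set 'I_d}) :
  set_submx M S T = restr_mx S *m M *m (restr_mx T)^T.
Proof.
apply/matrixP=> a b; rewrite !mxE (bigD1 (enum_val b)) //= !mxE eqxx mulr1.
rewrite [X in _ + X]big1 ?addr0 => [|l lb]; last first.
  by rewrite !mxE eq_sym (negPf lb) mulr0.
rewrite (bigD1 (enum_val a)) //= mxE eqxx mul1r big1 ?addr0 // => l la.
by rewrite mxE eq_sym (negPf la) mul0r.
Qed.

End Restriction.

(** * Entries of the operators at a fixed multi-index *)

Section Values.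

Variables (F : fieldType) (d : nat) (x y : 'I_d -> F) (beta : 'M[F]_d).

(** With [x p] and [y p] the entries of the identity and of A_p at mode [p], this is the entry of
    the Kronecker product over [S] that carries A at the modes in [T]. *)
Definition site_prod (T S : {set 'I_d}) : F :=
  \prod_(p in S) (if p \in T then y p else x p).

(** The entry of H_S. All ordered pairs are summed; for strictly upper triangular [beta] only those
    with [l < m] survive. *)
Definition pair_sum (S : {set 'I_d}) : F :=
  \sum_(l in S) \sum_(m in S) beta l m * site_prod [set l; m] S.

Definition site_row (S : {set 'I_d}) : 'rV[F]_d :=
  \row_l (site_prod [set l] S *+ (l \in S)).

Lemma site_prodU (T S1 S2 : {set 'I_d}) : [disjoint S1 & S2] ->
  site_prod T (S1 :|: S2) = site_prod T S1 * site_prod T S2.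
Proof. by move=> dS; rewrite /site_prod big_disjoint_setU. Qed.

Lemma site_prodUr (T T' S : {set 'I_d}) : [disjoint T' & S] ->
  site_prod (T :|: T') S = site_prod T S.
Proof.
move=> dT; apply: eq_bigr => p pS.
by rewrite inE (disjointFl dT pS) orbF.
Qed.

Lemma site_prodUl (T T' S : {set 'I_d}) : [disjoint T & S] ->
  site_prod (T :|: T') S = site_prod T' S.
Proof. by rewrite setUC; apply: site_prodUr. Qed.

Lemma site_prod0 (T S : {set 'I_d}) : [disjoint T & S] ->
  site_prod T S = site_prod set0 S.
Proof. by move=> dT; rewrite -[T]set0U site_prodUr. Qed.

Lemma site_rowU (S1 S2 : {set 'I_d}) : [disjoint S1 & S2] ->
  site_row (S1 :|: S2) =
    site_prod set0 S2 *: site_row S1 + site_prod set0 S1 *: site_row S2.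
Proof.
move=> dS; apply/rowP=> l; rewrite !mxE inE site_prodU //.
have [l1 | l1] := boolP (l \in S1).
  rewrite (disjointFr dS l1) /= mulr0 addr0 mulrC (site_prod0 (S := S2)) //.
  by rewrite disjoints1 (disjointFr dS l1).
have [l2 | l2] := boolP (l \in S2); last by rewrite !mulr0 addr0.
by rewrite mulr0 add0r (site_prod0 (S := S1)) // disjoints1.
Qed.

Lemma site_row_mask (S : {set 'I_d}) : site_row S *m mask_mx F S = site_row S.
Proof.
by apply/rowP=> l; rewrite mul_mx_diag !mxE; case: (l \in S);
  rewrite ?mulr1 ?mulr0.
Qed.

Lemma site_row_form (S1 S2 : {set 'I_d}) (M : 'M[F]_d) :
  (site_row S1 *m M *m (site_row S2)^T) ord0 ord0 =
  \sum_(l in S1) \sum_(m in S2)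
     M l m * (site_prod [set l] S1 * site_prod [set m] S2).
Proof.
rewrite mxE exchange_big /= [RHS]big_mkcond; apply: eq_bigr => m _.
rewrite !mxE; case: (m \in S2); last by rewrite mulr0.
rewrite big_distrl /= [RHS]big_mkcond; apply: eq_bigr => l _; rewrite mxE.
by case: (l \in S1); rewrite /= ?mul0r // mulrAC mulrC.
Qed.

(** A mixed pair occurs in both orders with the same operator; the two coefficients add up, which is
    how [beta + beta^T] enters. *)
Lemma pair_sumU (S1 S2 : {set 'I_d}) : [disjoint S1 & S2] ->
  pair_sum (S1 :|: S2) =
    pair_sum S1 * site_prod set0 S2 + site_prod set0 S1 * pair_sum S2
    + (site_row S1 *m (beta + beta^T) *m (site_row S2)^T) ord0 ord0.
Proof.
move=> dS; have dS' : [disjoint S2 & S1] by rewrite disjoint_sym.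
rewrite site_row_form /pair_sum big_disjoint_setU //=.
under eq_bigr do rewrite big_disjoint_setU //=.
under [X in _ + X]eq_bigr do rewrite big_disjoint_setU //=.
rewrite !big_split /= [X in _ + X]addrC addrACA; congr (_ + _ + _).
- rewrite big_distrl; apply: eq_bigr => l l1 /=.
  rewrite big_distrl; apply: eq_bigr => m m1 /=.
  rewrite site_prodU // (site_prodUr _ (S := S2)) ?(site_prod0 (S := S2));
    by rewrite ?mulrA // disjoints1 (disjointFr dS).
- rewrite big_distrr; apply: eq_bigr => l l2 /=.
  rewrite big_distrr; apply: eq_bigr => m m2 /=.
  rewrite site_prodU // (site_prodUr _ (S := S1)) ?(site_prod0 (S := S1));
    by rewrite 1?mulrCA // disjoints1 (disjointFl dS).
rewrite [X in _ + X]exchange_big -big_split; apply: eq_bigr => l l1 /=.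
rewrite -big_split; apply: eq_bigr => m m2 /=.
rewrite (setUC [set m]) -mulrDl !mxE site_prodU // site_prodUr ?site_prodUl //.
  by rewrite disjoints1 (disjointFr dS).
by rewrite disjoints1 (disjointFl dS).
Qed.

End Values.

(** * Rank factorization and pseudo-inverses *)

Section Base.

Variables (F : fieldType) (m n : nat) (A : 'M[F]_(m, n)).

(** The pseudo-inverse is a left inverse since [col_base A] has full column rank, and [A] factors
    through [col_base A]. *)
Lemma col_base_pinvK : col_base A *m pinvmx (col_base A) *m A = A.
Proof.
have: col_base A *m pinvmx (col_base A) *m (col_base A *m row_base A)
    = col_base A *m row_base A.
  by rewrite mulmxA -(mulmxA (col_base A)) mulVpmx ?col_base_full // mulmx1.
by rewrite mulmx_base.
Qed.

Lemma mulmx_pinv_row_base : A *m pinvmx (row_base A) = col_base A.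
Proof.
have: col_base A *m row_base A *m pinvmx (row_base A) = col_base A.
  by rewrite -mulmxA mulmxVp ?row_base_free // mulmx1.
by rewrite mulmx_base.
Qed.

End Base.

(** * Encodings of the basis matrices and the transfer step *)

Section Encoding.

Variables (F : fieldType) (d : nat) (beta : 'M[F]_d).

Let beta_s := beta + beta^T.

Definition cut_mx (S : {set 'I_d}) : 'M[F]_d :=
  mask_mx F S *m beta_s *m mask_mx F (~: S).

(* The columns of the basis matrix U_S of a subtree with leaf set S are
   enc_one k * I + enc_ham k * H_S + \sum_(l in S) enc_site l k * A^(l); the
   three dec_* matrices express I, H_S and the needed combinations of the A^(l)
   in terms of these columns. *)
Record encoding := Encoding {
  enc_rank : nat;
  enc_one : 'rV[F]_enc_rank;
  enc_ham : 'rV[F]_enc_rank;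
  enc_site : 'M[F]_(d, enc_rank);
  dec_one : 'cV[F]_enc_rank;
  dec_ham : 'cV[F]_enc_rank;
  dec_site : 'M[F]_(enc_rank, d)
}.

(** A single leaf contains no pair, so H_S is encoded and decoded by 0, and the two columns are I
    and A_l. *)
Definition leaf_enc (l : 'I_d) : encoding :=
  @Encoding (1 + 1) (row_mx 1%:M 0) 0 (row_mx 0 (delta_mx l 0))
    (col_mx 1%:M 0) 0 (col_mx 0 (delta_mx 0 l)).

(** [pinvmx Q] sends a vector of the column space of the block to its coordinates in the basis
    [Q]. *)
Definition node_enc (S : {set 'I_d}) : encoding :=
  let Q := col_base (set_submx beta_s S (~: S)) in
  @Encoding (1 + (1 + \rank (set_submx beta_s S (~: S))))
    (row_mx 1%:M 0) (row_mx 0 (row_mx 1%:M 0))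
    (row_mx 0 (row_mx 0 ((restr_mx F S)^T *m Q)))
    (col_mx 1%:M 0) (col_mx 0 (col_mx 1%:M 0))
    (col_mx 0 (col_mx 0 (pinvmx Q *m restr_mx F S))).

(** Only the column of the Hamiltonian is kept, which gives rank 1; nothing is decoded above the
    root, so the decoders are set to 0. *)
Definition root_enc : encoding := @Encoding 1 0 1%:M 0 0 0 0.

Definition tree_enc (t : dim_tree d) : encoding :=
  match t with
  | Leaf l => leaf_enc l
  | Node _ _ =>
      if leaves t == [set: 'I_d] then root_enc else node_enc (leaves t)
  end.

(** Slice [k] of the transfer tensor, as a bilinear form on the children. The summands produce in
    turn I, the Hamiltonian with its interaction term, the sites in [S1] and the sites in [S2]. *)
Definition transfer (E1 E2 E : encoding) (S1 S2 : {set 'I_d})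
    (k : 'I_(enc_rank E)) : 'M[F]_(enc_rank E1, enc_rank E2) :=
  let cross := mask_mx F S1 *m beta_s *m mask_mx F S2 in
  enc_one E ord0 k *: (dec_one E1 *m (dec_one E2)^T)
  + enc_ham E ord0 k *:
      (dec_ham E1 *m (dec_one E2)^T + dec_one E1 *m (dec_ham E2)^T
       + dec_site E1 *m cross *m (dec_site E2)^T)
  + dec_site E1 *m (mask_mx F S1 *m col k (enc_site E)) *m (dec_one E2)^T
  + dec_one E1 *m (dec_site E2 *m (mask_mx F S2 *m col k (enc_site E)))^T.

Lemma tr_mask_mx (S : {set 'I_d}) : (mask_mx F S)^T = mask_mx F S.
Proof. exact: tr_diag_mx. Qed.

Lemma tr_beta_s : beta_s^T = beta_s.
Proof. by rewrite /beta_s linearD /= trmxK addrC. Qed.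

Lemma cut_mxE (S : {set 'I_d}) :
  cut_mx S = (restr_mx F S)^T *m set_submx beta_s S (~: S) *m restr_mx F (~: S).
Proof. by rewrite set_submxE /cut_mx -!tr_restr_mul !mulmxA. Qed.

(** Nestedness of the blocks: columns outside [S] are also outside [S'], so the rows in [S'] of the
    block of [S] form a set of columns of the block of [S']. *)
Lemma mask_cut_mx (S S' : {set 'I_d}) : S' \subset S ->
  mask_mx F S' *m cut_mx S = cut_mx S' *m mask_mx F (~: S).
Proof.
move=> sSS; rewrite /cut_mx !mulmxA mask_mxI -[RHS]mulmxA mask_mxI.
by rewrite (setIidPl sSS) -setCU (setUidPr sSS).
Qed.

Lemma cut_mx_mask (S T : {set 'I_d}) : [disjoint S & T] ->
  cut_mx S *m mask_mx F T = mask_mx F S *m beta_s *m mask_mx F T.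
Proof.
move=> dST; rewrite /cut_mx -mulmxA mask_mxI (setIidPr _) //.
by rewrite -disjoints_subset disjoint_sym.
Qed.

Variables (x y : 'I_d -> F).

Local Notation site_row := (site_row x y).
Local Notation site_prod := (site_prod x y).
Local Notation pair_sum := (pair_sum x y beta).

(** The row of the basis matrix U_S at the multi-index fixed by [x] and [y]. *)
Definition enc_row (E : encoding) (S : {set 'I_d}) : 'rV[F]_(enc_rank E) :=
  site_prod set0 S *: enc_one E + pair_sum S *: enc_ham E
  + site_row S *m enc_site E.

(** The individual A^(l) need not be recoverable from the columns kept; recovery is demanded only
    for their combinations with weights in the column space of the block. *)
Definition decodable (E : encoding) (S : {set 'I_d}) : Prop :=
  [/\ enc_row E S *m dec_one E = (site_prod set0 S)%:M,
      enc_row E S *m dec_ham E = (pair_sum S)%:M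
    & enc_row E S *m dec_site E *m cut_mx S = site_row S *m cut_mx S].

Lemma leaf_enc_row (l : 'I_d) :
  enc_row (leaf_enc l) [set l] = row_mx (x l)%:M (y l)%:M.
Proof.
rewrite /enc_row /= scaler0 addr0 mul_mx_row mulmx0 scale_row_mx add_row_mx.
rewrite scaler0 addr0 add0r scale_scalar_mx mulr1 /site_prod big_set1 inE.
congr (row_mx _ _); apply/rowP=> j; rewrite ord1 !mxE (bigD1 l) //= !mxE.
rewrite big1 => [|m ml]; last by rewrite !mxE !inE (negPf ml) mul0r.
by rewrite /site_prod big_set1 !inE !eqxx mulr1 addr0.
Qed.

Lemma leaf_decodable (l : 'I_d) : beta l l = 0 -> decodable (leaf_enc l) [set l].
Proof.
move=> bl; rewrite /decodable leaf_enc_row /= !mul_row_col.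
rewrite !mulmx0 !addr0 add0r mulmx1 /site_prod big_set1 inE; split=> //.
  by rewrite /pair_sum !big_set1 bl mul0r raddf0.
congr (_ *m _); apply/rowP=> m; rewrite mul_scalar_mx !mxE !inE /=.
have [-> | _] := eqP; last by rewrite mulr0.
by rewrite /site_prod big_set1 set11 mulr1.
Qed.

Lemma root_enc_row (S : {set 'I_d}) : enc_row root_enc S = (pair_sum S)%:M.
Proof. by rewrite /enc_row /= scaler0 add0r mulmx0 addr0 scalemx1. Qed.

Lemma node_enc_proj (S : {set 'I_d}) :
  let Q := col_base (set_submx beta_s S (~: S)) in
  (restr_mx F S)^T *m Q *m (pinvmx Q *m restr_mx F S) *m cut_mx S = cut_mx S.
Proof.
rewrite cut_mxE /=; set B := set_submx _ _ _.
have := col_base_pinvK B; move: (col_base B) (pinvmx _) => Q P QPB.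
rewrite !mulmxA -[X in X *m B]mulmxA restr_mxK mulmx1.
by rewrite -(mulmxA _ Q) -(mulmxA _ (Q *m P)) QPB.
Qed.

Lemma node_decodable (S : {set 'I_d}) : decodable (node_enc S) S.
Proof.
have := node_enc_proj S; rewrite /decodable /enc_row /node_enc /=.
move: (_ *m col_base _) (pinvmx _ *m _) => q D qD.
rewrite !mulmxDl -!scalemxAl -!mulmxA !mul_col_mx !mul_row_col.
rewrite !(mulmx0, mul0mx, scaler0, addr0, add0r, mulmx1).
by rewrite !scalemx1 [q *m _]mulmxA qD.
Qed.

Lemma tree_decodable (t : dim_tree d) : (forall l, beta l l = 0) ->
  leaves t != [set: 'I_d] -> decodable (tree_enc t) (leaves t).
Proof.
case: t => [l|t1 t2] b0 lt; first exact: leaf_decodable.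
by rewrite /tree_enc (negPf lt); apply: node_decodable.
Qed.

(** A right inverse of [row_base B] expresses [Q] through the columns of the block [B]; the root
    encodes no site sums. This is what lets children supply the site sums of their parent. *)
Lemma tree_enc_site (t1 t2 : dim_tree d) :
  exists V, enc_site (tree_enc (Node t1 t2)) = cut_mx (leaves (Node t1 t2)) *m V.
Proof.
rewrite /tree_enc; case: eqP => _; first by exists 0; rewrite mulmx0.
set S := leaves _; set B := set_submx beta_s S (~: S).
exists (row_mx 0 (row_mx 0 ((restr_mx F (~: S))^T *m pinvmx (row_base B)))).
rewrite !mul_mx_row !mulmx0 mulmxA cut_mxE /=; congr (row_mx _ (row_mx _ _)).
rewrite -[X in X *m pinvmx _]mulmxA restr_mxK mulmx1 -mulmxA.
by rewrite mulmx_pinv_row_base.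
Qed.

Lemma transfer_row (E1 E2 E : encoding) (S1 S2 : {set 'I_d})
    (k : 'I_(enc_rank E)) :
  [disjoint S1 & S2] -> decodable E1 S1 -> decodable E2 S2 ->
  (exists V, enc_site E = cut_mx (S1 :|: S2) *m V) ->
  (enc_row E1 S1 *m transfer E1 E2 S1 S2 k *m (enc_row E2 S2)^T) ord0 ord0
    = enc_row E (S1 :|: S2) ord0 k.
Proof.
move=> dS [one1 ham1 site1] [one2 ham2 site2] [V defV].
have dS' : [disjoint S2 & S1] by rewrite disjoint_sym.
(* The site weights lie in the column space of the parent block, whose rows in [S'] lie in that of
   the child block, so the child can decode them. *)
have siteP (E' : encoding) (S' : {set 'I_d}) : S' \subset S1 :|: S2 ->
    enc_row E' S' *m dec_site E' *m cut_mx S' = site_row S' *m cut_mx S' ->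
    enc_row E' S' *m (dec_site E' *m (mask_mx F S' *m col k (enc_site E)))
      = site_row S' *m col k (enc_site E).
  move=> sS'; rewrite defV colE.
  move: (mask_cut_mx sS').
  move: (cut_mx _) (cut_mx S') => C C' maskC site'.
  rewrite !mulmxA -[_ *m mask_mx F S' *m C]mulmxA maskC mulmxA site'.
  by rewrite -[_ *m C' *m _]mulmxA -maskC mulmxA site_row_mask.
have cross1 := cut_mx_mask dS; have cross2 := cut_mx_mask dS'.
(* By symmetry of [beta_s], the second child decodes the same interaction block, transposed. *)
have cross_tr : mask_mx F S2 *m beta_s *m mask_mx F S1
    = (mask_mx F S1 *m beta_s *m mask_mx F S2)^T.
  by rewrite !trmx_mul !tr_mask_mx tr_beta_s mulmxA.
have crossE : enc_row E1 S1 *m (dec_site E1 *m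
      (mask_mx F S1 *m beta_s *m mask_mx F S2) *m (dec_site E2)^T)
      *m (enc_row E2 S2)^T
    = site_row S1 *m beta_s *m (site_row S2)^T.
  transitivity (site_row S1 *m (mask_mx F S1 *m beta_s *m mask_mx F S2)
                 *m (site_row S2)^T).
    rewrite {}cross_tr in cross2; move: cross1 cross2 site1 site2.
    move: (mask_mx F S1 *m _ *m _) (cut_mx S1) (cut_mx S2) => X C1 C2.
    move=> cross1 cross2 site1 site2.
    have p1X : enc_row E1 S1 *m dec_site E1 *m X = site_row S1 *m X.
      by rewrite -cross1 !mulmxA site1.
    have p2X : X *m (dec_site E2)^T *m (enc_row E2 S2)^T = X *m (site_row S2)^T.
      apply: trmx_inj; rewrite !trmx_mul !trmxK -cross2 !mulmxA.
      by rewrite site2.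
    by rewrite !mulmxA p1X -!mulmxA; congr (_ *m _); rewrite mulmxA.
  rewrite !mulmxA site_row_mask -!mulmxA -[in X in _ *m X]tr_mask_mx.
  by rewrite -[_^T *m _]trmx_mul site_row_mask.
have site1E := siteP E1 S1 (subsetUl _ _) site1.
have site2E := siteP E2 S2 (subsetUr _ _) site2.
have mulmx_col (p : 'rV[F]_d) :
    (p *m enc_site E) ord0 k = (p *m col k (enc_site E)) ord0 ord0.
  by rewrite colE mulmxA -colE [RHS]mxE.
have -> : enc_row E (S1 :|: S2) ord0 k =
    site_prod set0 S1 * site_prod set0 S2 * enc_one E ord0 k
    + (pair_sum S1 * site_prod set0 S2 + site_prod set0 S1 * pair_sum S2
       + (site_row S1 *m beta_s *m (site_row S2)^T) ord0 ord0) * enc_ham E ord0 k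
    + (site_prod set0 S2 * (site_row S1 *m col k (enc_site E)) ord0 ord0
       + site_prod set0 S1 * (site_row S2 *m col k (enc_site E)) ord0 ord0).
  rewrite /enc_row site_rowU // pair_sumU // site_prodU // mulmxDl -!scalemxAl.
  rewrite -/beta_s -!mulmx_col; move: (site_row S1 *m beta_s *m _) => f.
  move: (site_row S1 *m _) (site_row S2 *m _) => q1 q2.
  by rewrite !mxE.
rewrite -crossE -site1E -site2E /transfer; clear - one1 ham1 one2 ham2.
move: one1 ham1 one2 ham2; move: (enc_row E1 S1) (enc_row E2 S2) => u1 u2.
move: (mask_mx F S1 *m _ *m _) => X.
move: (mask_mx F S1 *m _) (mask_mx F S2 *m _) => c1 c2 one1 ham1 one2 ham2.
(* Every summand of [transfer] has the shape [p *m q^T] up to a scalar, so the form splits into one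
   decoding at each child. *)
have bilin r (p : 'M_(_, r)) (q : 'M_(_, r)) :
    u1 *m (p *m q^T) *m u2^T = (u1 *m p) *m (u2 *m q)^T.
  by rewrite trmx_mul !mulmxA.
rewrite !(mulmxDl, mulmxDr) -!(scalemxAl, scalemxAr) !(mulmxDl, mulmxDr) !bilin.
rewrite one1 one2 ham1 ham2 !tr_scalar_mx !mul_scalar_mx !mul_mx_scalar.
move: (u1 *m _ *m _) => f; move: (u1 *m _) (u2 *m _) => v1 v2.
by rewrite !mxE eqxx !mulr1n; ring.
Qed.

End Encoding.

(** * The tree tensor network of the Hamiltonian *)

Section TreeTensorNetwork.

Variables (F : fieldType) (d : nat).

Definition ttn_row (N : 'I_d -> nat) (Y : ttn F N) (i : forall k, 'I_(N k))
    (t : dim_tree d) : 'rV[F]_(ttn_rank Y t) :=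
  row (tree_index i t) (ttn_mx Y t).

Lemma ttn_row_node (N : 'I_d -> nat) (Y : ttn F N) (i : forall k, 'I_(N k))
    (t1 t2 : dim_tree d) (k : 'I_(ttn_rank Y (Node t1 t2))) :
  ttn_row Y i (Node t1 t2) ord0 k =
    (ttn_row Y i t1 *m (\matrix_(a, b) ttn_transfer a b k)
       *m (ttn_row Y i t2)^T) ord0 ord0.
Proof.
rewrite /ttn_row [LHS]mxE [LHS]mxE [RHS]mxE.
rewrite (reindex (@mxtens_index _ _)) /=; last first.
  exists (@mxtens_unindex _ _) => p _;
    by rewrite ?mxtens_indexK ?mxtens_unindexK.
(* The index [b] of the second child is the slow component of the merged index of [mat12]. *)
transitivity (\sum_b \sum_a
  (ttn_mx Y t2 *t ttn_mx Y t1) (tree_index i (Node t1 t2)) (mxtens_index (b, a))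
  * mat12 (@ttn_transfer _ _ _ Y t1 t2) (mxtens_index (b, a)) k).
  by rewrite pair_bigA; apply: eq_bigr => -[b a].
apply: eq_bigr => b _; rewrite !mxE big_distrl; apply: eq_bigr => a _ /=.
by rewrite tensmxE !mxE mxtens_indexK /= -mulrA mulrC.
Qed.

Variables (n : 'I_d -> nat) (A : forall k, 'M[F]_(n k)) (beta : 'M[F]_d).

Let mode (k : 'I_d) := (n k * n k)%N.

Definition hamiltonian_ttn : ttn F mode :=
  @TTN F d mode (fun s => enc_rank (tree_enc beta s))
    (fun l => row_mx (col_vec 1%:M) (col_vec (A l)))
    (fun t1 t2 a b k => transfer beta (tree_enc beta t1) (tree_enc beta t2)
       (leaves t1) (leaves t2) k a b).

Variable (i : forall k, 'I_(mode k)).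

Let x (l : 'I_d) := col_vec (1%:M : 'M[F]_(n l)) (i l) ord0.
Let y (l : 'I_d) := col_vec (A l) (i l) ord0.

(** Induction on the tree: a child misses the leaves of its sibling, so no child has the root
    encoding and both are decodable. *)
Lemma hamiltonian_ttn_row (t : dim_tree d) :
  (forall l, beta l l = 0) -> ordered_tree t ->
  ttn_row hamiltonian_ttn i t = enc_row beta x y (tree_enc beta t) (leaves t).
Proof.
move=> b0; elim: t => [l _ | t1 IH1 t2 IH2 ot].
  rewrite leaf_enc_row /ttn_row /= row_row_mx; congr (row_mx _ _);
  by apply/rowP=> j; rewrite !ord1 [LHS]mxE [RHS]mxE.
have dis := disjoint_leaves ot; have [o1 o2 _] := and3P ot.
apply/rowP=> k; rewrite ttn_row_node IH1 // IH2 //.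
have -> : \matrix_(a, b) ttn_transfer a b k
    = transfer beta (tree_enc beta t1) (tree_enc beta t2)
        (leaves t1) (leaves t2) k.
  by apply/matrixP=> a b; rewrite mxE.
apply: transfer_row => //; last exact: tree_enc_site.
  exact: tree_decodable b0 (proper_subset_disjoint (subxx _) dis (leaves_neq0 _)).
rewrite disjoint_sym in dis.
exact: tree_decodable b0 (proper_subset_disjoint (subxx _) dis (leaves_neq0 _)).
Qed.

Lemma hamiltonian_entry : strictly_upper beta ->
  hamiltonian A beta (lin_index (fun k => (vec_unindex (i k)).2))
      (lin_index (fun k => (vec_unindex (i k)).1))
    = pair_sum x y beta [set: 'I_d].
Proof.
move=> upper; rewrite summxE /pair_sum.
apply: eq_big => [l | l _]; first by rewrite inE.
rewrite summxE big_mkcond [RHS]big_mkcond; apply: eq_bigr => m _; rewrite inE.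
case: ltnP => [lm | /upper->]; last by rewrite mul0r.
rewrite mxE kron_mul kronE; congr (_ * _).
rewrite [RHS]big_mkcond; apply: eq_bigr => p _; rewrite !inE /x /y !col_vecE.
(* As [l < m], each mode carries at most one factor other than the identity, so no square of A
   arises. *)
have [-> | pl] := eqVneq p l.
  by rewrite -(inj_eq val_inj) ltn_eqF // mulmx1.
by case: eqP => _; rewrite mul1mx.
Qed.

End TreeTensorNetwork.

Theorem theorem3p3 (R : realType) (d : nat) (hd : (2 <= d)%N)
    (t : dim_tree d) (ht : is_dimension_tree t)
    (n : 'I_d -> nat) (A : forall k : 'I_d, 'M[R[i]]_(n k))
    (beta : 'M[R[i]]_d) (hbeta : strictly_upper beta) :
  exists Y : ttn R[i] (fun k : 'I_d => n k * n k)%N,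
    [/\ is_ttno t (hamiltonian A beta) Y,
        forall l : 'I_d, l \in leaves t -> ttn_rank Y (Leaf l) = 2%N
      & forall s : dim_tree d, inner_subtree t s -> s <> t ->
          ttn_rank Y s
            = (2 + \rank (set_submx (beta + beta^T) (leaves s) (~: leaves s)))%N
          /\ (2 + \rank (set_submx (beta + beta^T) (leaves s) (~: leaves s))
                <= 2 + #|leaves s|)%N].
Proof.
have [ot /eqP lt] := andP ht; exists (hamiltonian_ttn A beta); split=> //.
(* Since [d] is at least 2, the whole tree is not a single leaf. *)
- have root : tree_enc beta t = root_enc _ d.
    case: t lt {ht ot} => [l lt | t1 t2 lt]; last by rewrite /tree_enc lt eqxx.
    by have := congr1 (fun S : {set 'I_d} => #|S|) lt;
      rewrite cards1 cardsT card_ord => d1; rewrite -d1 in hd.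
  exists (op_reshape (hamiltonian A beta)); first exact: is_reshape_op_reshape.
  have size_t : tree_size (fun k => n k * n k)%N t
      = mode_prod (fun k => n k * n k)%N.
    by rewrite tree_sizeE // mode_prodE lt; apply: eq_bigl => l; rewrite inE.
  have rank_t : ttn_rank (hamiltonian_ttn A beta) t = 1%N by rewrite /= root.
  exists (size_t, rank_t) => i; rewrite ffunE hamiltonian_entry //.
  rewrite castmxE /= -(tree_index_root i size_t ht) cast_ordK.
  have := hamiltonian_ttn_row A i (fun l => hbeta l l (leqnn l)) ot.
  move/rowP/(_ (cast_ord (esym rank_t) ord0)); rewrite mxE => ->.
  (* The column index is generalized first, since its type depends on the encoding being
     rewritten. *)
  move: (cast_ord _ _) => /=; rewrite root lt => k.
  by rewrite root_enc_row mxE (ord1 (k : 'I_1)).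
move=> s st nst; split; last by rewrite leq_add2l rank_leq_row.
have := proper_subtree_leaves ot st nst; have [s1 [s2 ->]] := inner_subtreeP st.
by move=> /negPf /=; rewrite /tree_enc => ->.
Qed.
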